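(* Let $\varepsilon>0$, $\eta'>0$, and suppose that an approximate gradient $\tilde\nabla\ell$ is available with $\|\tilde\nabla\ell(u)-\nabla\ell(u)\|\le\eta'$ for each $u\in\mathbb B_{R_0}$. Then one may set $L=\max\Big\{1,\frac{\lambda_{\max}(\mathrm B_0^{\intercal}\mathrm B_0)}{\lambda_{\min}(\mathrm B_1^{\intercal}\mathrm B_1)+\varepsilon}-1\Big\}$ (a Lipschitz constant of $\nabla\ell$) in the algorithm below, and, with $u^\star$ a minimizer of $\ell$, the following hold for its iterates after $J$ iterations. (1) If $\ell$ is convex, $$\min_{1\le j\le J}\|2L(u_j-z_j)\|^2\le\frac{96L^2}{J(J+1)(J+2)}\|s_0-u^\star\|^2+16LR_0\eta'.$$ (2) If $\ell$ is nonconvex and $L'$ is a Lipschitz constant of $\nabla(\ell-\frac12\|\cdot\|^2)$, e.g. $L'=\frac{\lambda_{\max}(\mathrm B_0^{\intercal}\mathrm B_0)}{\lambda_{\min}(\mathrm B_1^{\intercal}\mathrm B_1)+\varepsilon}$, then $$\min_{1\le j\le J}\|2L(u_j-z_j)\|^2\le\frac{96L^2}{J(J+1)(J+2)}\|s_0-u^\star\|^2+\frac{24LL'}{J}\Big(\|u^\star\|^2+\frac54R_0^2\Big)+16LR_0\eta'.$$ Algorithm (inexact accelerated gradient method): given $z_1=s_0\in\mathbb B_{R_0}$ and $\beta_j=\frac1{2L}$, $\gamma_j=\frac j{4L}$, $\tau_j=\frac2{j+2}$, for $j=1,\dots,J$ compute $g_j=\tilde\nabla\ell(z_j)$, $u_j=P(z_j-\beta_jg_j)$,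 $s_j=P(s_{j-1}-\gamma_jg_j)$, $z_{j+1}=\tau_js_j+(1-\tau_j)u_j$, where $P(y)=\min(1,R_0/\|y\|)\,y$ is the projection onto $\mathbb B_{R_0}$.
   Context: $\mathcal X_0=\{x_0^{(1)},\dots,x_0^{(N_0)}\}$ and $\mathcal X_1=\{x_1^{(1)},\dots,x_1^{(N_1)}\}$ are finite sets, $\mu_0,\mu_1$ probability measures with full support on them, $k=N_0N_1$, and $\mathcal K=\{x\in\mathbb R^k:x\ge0,\ \sum_jx_{(i-1)N_1+j}=\mu_0(\{x_0^{(i)}\})\ \forall i,\ \sum_ix_{(i-1)N_1+j}=\mu_1(\{x_1^{(j)}\})\ \forall j\}$ is the set of vectorized couplings. $\mathsf H(x)=-\sum_ix_i\log x_i$. $\mathrm M=\mathrm B_1^{\intercal}\mathrm B_1-\mathrm B_0^{\intercal}\mathrm B_0\in\mathbb R^{k\times k}$ is the symmetric matrix with $\frac12x^{\intercal}\mathrm Mx=\int|\kappa_0(x,x')-\kappa_1(y,y')|^pd\pi\otimes\pi$ whenever $x$ represents the coupling $\pi$ (for given $p>0$ and $\kappa_i:\mathcal X_i\times\mathcal X_i\to\mathbb R$), with $\mathrm B_0\in\mathbb R^{r_0\times k}$, $\mathrm B_1\in\mathbb R^{r_1\times k}$. The objective is $$\ell(u)=\tfrac12\|u\|^2+\sup_{v\in\mathbb R^{r_1}}\Big\{-\tfrac12\|v\|^2+\inf_{x\in\mathcal K}\{(\mathrm B_1^{\intercal}v-\mathrm B_0^{\intercal}u)^{\intercal}x-\varepsilon\mathsf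 H(x)\}\Big\},\quad u\in\mathbb R^{r_0},$$ which for $\varepsilon>0$ is differentiable. $R_0=\|\mathrm B_0\|_{1,2}=\sup_{\|x\|_1\le1}\|\mathrm B_0x\|_2$, and $\mathbb B_{R_0}$ is the closed Euclidean ball of radius $R_0$ centered at $0$ in $\mathbb R^{r_0}$ (it contains all minimizers of $\ell$). $\lambda_{\max},\lambda_{\min}$ are the largest and smallest eigenvalues of the indicated $k\times k$ matrices. *)

(* Defs.v *)
(* MathComp / MathComp-Analysis. *)
From mathcomp Require Import all_boot all_order all_algebra.
From mathcomp Require Import all_classical all_reals all_analysis.

Set Implicit Arguments.
Unset Strict Implicit.
Unset Printing Implicit Defensive.

Import Order.TTheory GRing.Theory Num.Theory.
Import numFieldNormedType.Exports.

Local Open Scope classical_set_scope.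
Local Open Scope ring_scope.

(* The norm carried by matrices in the library is the sup norm, so the
   Euclidean norm is defined here; both induce the same topology, hence the
   same notion of differentiability. *)
Definition dot (R : realType) n (x y : 'cV[R]_n) : R :=
  \sum_(i < n) x i 0 * y i 0.

Definition norm1 (R : realType) n (x : 'cV[R]_n) : R := \sum_(i < n) `|x i 0|.

Definition norm2 (R : realType) n (x : 'cV[R]_n) : R := Num.sqrt (dot x x).

Definition norm12 (R : realType) m n (B : 'M[R]_(m, n)) : R :=
  sup [set norm2 (B *m x) | x in [set x : 'cV[R]_n | norm1 x <= 1]].

Definition ball2 (R : realType) n (r : R) : set 'cV[R]_n :=
  [set y | norm2 y <= r].

(* For y = 0 the quotient is r / 0 = 0, and the result is 0 as it should be. *)
Definition proj_ball2 (R : realType) n (r : R) (y : 'cV[R]_n) : 'cV[R]_n :=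
  Num.min 1 (r / norm2 y) *: y.

(* For a symmetric A of positive size the set of eigenvalues is finite and
   nonempty, so that sup and inf are attained. *)
Definition lambda_max (R : realType) n (A : 'M[R]_n) : R :=
  sup [set a | eigenvalue A a].

Definition lambda_min (R : realType) n (A : 'M[R]_n) : R :=
  inf [set a | eigenvalue A a].

(* The vector of partial derivatives; it is the gradient of f at u whenever f
   is differentiable at u. *)
Definition grad (R : realType) n (f : 'cV[R]_n -> R) (u : 'cV[R]_n) :
    'cV[R]_n :=
  \col_(i < n) 'D_(delta_mx i 0) f u.

Definition lipschitz2 (R : realType) m n (F : 'cV[R]_m -> 'cV[R]_n) (C : R) :
    Prop :=
  forall u v, norm2 (F u - F v) <= C * norm2 (u - v).

(* Measures on a finite set are given by the masses of the singletons. *)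
Definition full_support_prob (R : realType) (X : finType) (mu : X -> R) : Prop :=
  (forall a, 0 < mu a) /\ \sum_a mu a = 1.

Definition is_coupling (R : realType) (X0 X1 : finType)
    (mu0 : X0 -> R) (mu1 : X1 -> R) (pi : X0 * X1 -> R) : Prop :=
  [/\ forall ab, 0 <= pi ab,
      forall a, \sum_b pi (a, b) = mu0 a &
      forall b, \sum_a pi (a, b) = mu1 b].

(* Vectorization is row-major: with 0-based indices, mxvec_index i j is the
   ordinal i * N1 + j. *)
Definition represents (R : realType) (X0 X1 : finType) N0 N1
    (x0 : 'I_N0 -> X0) (x1 : 'I_N1 -> X1)
    (x : 'cV[R]_(N0 * N1)) (pi : X0 * X1 -> R) : Prop :=
  forall i j, x (mxvec_index i j) 0 = pi (x0 i, x1 j).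

Definition coupling_polytope (R : realType) (X0 X1 : finType) N0 N1
    (x0 : 'I_N0 -> X0) (x1 : 'I_N1 -> X1) (mu0 : X0 -> R) (mu1 : X1 -> R) :
    set 'cV[R]_(N0 * N1) :=
  [set x | [/\ forall l, 0 <= x l 0,
               forall i, \sum_(j < N1) x (mxvec_index i j) 0 = mu0 (x0 i) &
               forall j, \sum_(i < N0) x (mxvec_index i j) 0 = mu1 (x1 j)]].

(* The integral of |kappa0(a, a') - kappa1(b, b')|^p against pi (x) pi. *)
Definition distortion (R : realType) (X0 X1 : finType) (p : R)
    (kappa0 : X0 -> X0 -> R) (kappa1 : X1 -> X1 -> R) (pi : X0 * X1 -> R) : R :=
  \sum_(ab : X0 * X1) \sum_(ab' : X0 * X1)
    (`|kappa0 ab.1 ab'.1 - kappa1 ab.2 ab'.2| `^ p) * (pi ab * pi ab').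

Definition entropy (R : realType) n (x : 'cV[R]_n) : R :=
  - \sum_(i < n) x i 0 * ln (x i 0).

Definition objective (R : realType) k r0 r1 (K : set 'cV[R]_k)
    (B0 : 'M[R]_(r0, k)) (B1 : 'M[R]_(r1, k)) (eps : R) (u : 'cV[R]_r0) : R :=
  2^-1 * norm2 u ^+ 2 +
  sup [set - (2^-1 * norm2 v ^+ 2) +
           inf [set dot (B1^T *m v - B0^T *m u) x - eps * entropy x | x in K]
      | v in [set: 'cV[R]_r1]].

Definition is_minimizer (R : realType) n (f : 'cV[R]_n -> R) (u : 'cV[R]_n) :
    Prop :=
  forall w, f u <= f w.

Definition convex (R : realType) n (f : 'cV[R]_n -> R) : Prop :=
  @convex_function R 'cV[R]_n setT f.

(* The values of u at 0, and of all sequences past the range that J iterations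
   compute, are unconstrained. *)
Definition inexact_agm (R : realType) n (L R0 : R) (tgrad : 'cV[R]_n -> 'cV[R]_n)
    (J : nat) (s u z : nat -> 'cV[R]_n) : Prop :=
  [/\ s 0%N \in ball2 R0,
      z 1%N = s 0%N &
      forall j, (1 <= j <= J)%N ->
        let g := tgrad (z j) in
        let beta := 1 / (2 * L) in
        let gamma := j%:R / (4 * L) in
        let tau := 2 / (j%:R + 2) in
        [/\ u j = proj_ball2 R0 (z j - beta *: g),
            s j = proj_ball2 R0 (s j.-1 - gamma *: g) &
            z j.+1 = tau *: s j + (1 - tau) *: u j]].

(* The minimum of a 1, ..., a J, for 1 <= J. *)
Definition min_upto (R : realType) (J : nat) (a : nat -> R) : R :=
  \big[Num.min/a 1%N]_(1 <= j < J.+1) a j.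

(* Main.v *)
(* Let h(x) = |B1 x|^2/2 + eps * sum x ln x on the polytope K.  Exchanging sup
   and inf (the optimal v is B1 x_u), ell(u) = |u|^2/2 + f(u) with
   f(u) = min_K (h(x) - u.B0 x), attained at x_u.  As x ln x - x^2/2 is convex
   on [0,1], h is strongly convex of modulus lambda_min(B1^T B1) + eps, so that
   F(u) = B0 x_u, which is minus the gradient of the concave function f, is
   cocoercive: |F u - F w|^2 <= rho (u - w).(F u - F w), where
   rho = lambda_max(B0^T B0) / (lambda_min(B1^T B1) + eps).
   This gives the Lipschitz constants rho of F and max(1, rho - 1) of id - F,
   the descent inequality ell(w) <= ell(u) + grad ell(u).(w - u) + |w - u|^2/2,
   and F w = w, hence |w| <= R0, for each minimizer w of ell.

   The convergence rates follow Ghadimi and Lan: comparing u_j with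
   a s_j + (1 - a) u_(j-1), a = 2/(j+1), in its projection inequality, and s_j
   with the minimizer w, the energy
   j(j+1)/2 * (ell(u_j) - ell(w)) + 2L |s_j - w|^2 decreases by at least
   j(j+1)L/4 * |u_j - z_j|^2, up to the gradient error and a curvature term
   (absent when ell is convex), and the sum of the j(j+1)/2 is
   J(J+1)(J+2)/6. *)
Require Import Defs.
From HB Require Import structures.
From mathcomp Require Import all_boot all_order all_algebra.
From mathcomp Require Import all_classical all_reals all_analysis.
From mathcomp Require Import ring lra.
Import Order.TTheory GRing.Theory Num.Theory.
Import numFieldNormedType.Exports.
Local Open Scope classical_set_scope.
Local Open Scope ring_scope.

Set Implicit Arguments.
Unset Strict Implicit.
Unset Printing Implicit Defensive.

(** * Euclidean space *)

Section Euclidean.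
Variable R : realType.
Implicit Types (n m : nat) (a r : R).

Lemma dotC n (x y : 'cV[R]_n) : dot x y = dot y x.
Proof. by apply: eq_bigr => i _; rewrite mulrC. Qed.

Lemma dotDl n (x y w : 'cV[R]_n) : dot (x + y) w = dot x w + dot y w.
Proof.
by rewrite /dot -big_split /=; apply: eq_bigr => i _; rewrite mxE mulrDl.
Qed.

Lemma dotZl n a (x w : 'cV[R]_n) : dot (a *: x) w = a * dot x w.
Proof.
by rewrite /dot big_distrr /=; apply: eq_bigr => i _; rewrite mxE mulrA.
Qed.

Lemma dotNl n (x w : 'cV[R]_n) : dot (- x) w = - dot x w.
Proof. by rewrite -scaleN1r dotZl mulN1r. Qed.

Lemma dotDr n (w x y : 'cV[R]_n) : dot w (x + y) = dot w x + dot w y.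
Proof. by rewrite ![dot w _]dotC dotDl. Qed.

Lemma dotZr n a (w x : 'cV[R]_n) : dot w (a *: x) = a * dot w x.
Proof. by rewrite ![dot w _]dotC dotZl. Qed.

Lemma dotNr n (w x : 'cV[R]_n) : dot w (- x) = - dot w x.
Proof. by rewrite ![dot w _]dotC dotNl. Qed.

Lemma dot0l n (w : 'cV[R]_n) : dot 0 w = 0.
Proof. by rewrite -(scale0r 0) dotZl mul0r. Qed.

Definition dotE := (dotDl, dotDr, dotNl, dotNr, dotZl, dotZr).

Lemma dot_mulmxl m n (A : 'M[R]_(m, n)) (x : 'cV[R]_n) (y : 'cV[R]_m) :
  dot (A *m x) y = dot x (A^T *m y).
Proof.
have dotM k (u w : 'cV[R]_k) : dot u w = (u^T *m w) 0 0.
  by rewrite mxE; apply: eq_bigr => i _; rewrite mxE.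
by rewrite !dotM trmx_mul mulmxA.
Qed.

Lemma dot_ge0 n (x : 'cV[R]_n) : 0 <= dot x x.
Proof. by apply: sumr_ge0 => i _; rewrite -expr2 sqr_ge0. Qed.

Lemma dot_eq0 n (x : 'cV[R]_n) : dot x x = 0 -> x = 0.
Proof.
move=> /eqP; rewrite psumr_eq0 => [/allP x0|i _]; last first.
  by rewrite -expr2 sqr_ge0.
apply/matrixP => i j; rewrite ord1 mxE; apply/eqP.
by have := x0 i (mem_index_enum i); rewrite mulf_eq0 orbb.
Qed.

Lemma norm2_ge0 n (x : 'cV[R]_n) : 0 <= norm2 x.
Proof. exact: sqrtr_ge0. Qed.

Lemma sqr_norm2 n (x : 'cV[R]_n) : norm2 x ^+ 2 = dot x x.
Proof. by rewrite sqr_sqrtr// dot_ge0. Qed.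

Lemma norm2Z n a (x : 'cV[R]_n) : norm2 (a *: x) = `|a| * norm2 x.
Proof.
by rewrite /norm2 dotZl dotZr mulrA -expr2 sqrtrM ?sqr_ge0// sqrtr_sqr.
Qed.

Lemma norm2N n (x : 'cV[R]_n) : norm2 (- x) = norm2 x.
Proof. by rewrite /norm2 dotNl dotNr opprK. Qed.

Lemma norm20 n : norm2 (0 : 'cV[R]_n) = 0.
Proof. by rewrite /norm2 dot0l sqrtr0. Qed.

Lemma norm2_le n (x : 'cV[R]_n) r : 0 <= r ->
  (norm2 x <= r) = (dot x x <= r ^+ 2).
Proof.
by move=> r0; rewrite -sqr_norm2 ler_sqr// ?nnegrE ?norm2_ge0.
Qed.

(** The vector |y| x - |x| y has squared norm 2 |x| |y| (|x| |y| - x.y) >= 0; zero vectors are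
    treated apart before dividing. *)
Lemma cauchy_schwarz n (x y : 'cV[R]_n) : dot x y <= norm2 x * norm2 y.
Proof.
have := dot_ge0 (norm2 y *: x - norm2 x *: y).
rewrite !dotE (dotC y x) -!sqr_norm2 => h.
have := norm2_ge0 x; rewrite le0r => /orP[/eqP x0|x_gt0].
  by rewrite (_ : x = 0) ?dot0l ?norm20 ?mul0r//; apply: dot_eq0;
    rewrite -sqr_norm2 x0 expr0n.
have := norm2_ge0 y; rewrite le0r => /orP[/eqP y0|y_gt0].
  by rewrite (_ : y = 0) ?(dotC x) ?dot0l ?norm20 ?mulr0//; apply: dot_eq0;
    rewrite -sqr_norm2 y0 expr0n.
have xy : 0 < norm2 x * norm2 y by exact: mulr_gt0.
rewrite -(ler_pM2l xy); lra.
Qed.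

Lemma norm2D n (x y : 'cV[R]_n) : norm2 (x + y) <= norm2 x + norm2 y.
Proof.
rewrite norm2_le ?addr_ge0 ?norm2_ge0//.
have := cauchy_schwarz x y; rewrite !dotE (dotC y x) -!sqr_norm2; lra.
Qed.

Lemma norm2_conv n t (x y : 'cV[R]_n) r : 0 <= t <= 1 ->
  norm2 x <= r -> norm2 y <= r -> norm2 (t *: x + (1 - t) *: y) <= r.
Proof.
move=> /andP[t0 t1] xr yr; apply: (le_trans (norm2D _ _)).
rewrite !norm2Z !ger0_norm ?subr_ge0//.
have -> : r = t * r + (1 - t) * r by lra.
by apply: lerD; apply: ler_wpM2l => //; rewrite subr_ge0.
Qed.

Lemma norm2_proj_ball2 n r (y : 'cV[R]_n) : 0 <= r ->
  norm2 (proj_ball2 r y) <= r.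
Proof.
move=> r0; rewrite /proj_ball2 norm2Z ger0_norm; last first.
  by rewrite le_min ler01 divr_ge0 ?norm2_ge0.
have := norm2_ge0 y; rewrite le0r => /orP[/eqP ->|y0]; first by rewrite mulr0.
by rewrite -ler_pdivlMr// ge_min lexx orbT.
Qed.

(** For y outside the ball, y minus its projection is (1 - c) y with c = r / |y|, and y.(w - c y) =
    y.w - r |y| <= 0 by Cauchy-Schwarz. Inside the ball the first factor is 0. *)
Lemma proj_ball2_obtuse n r (y w : 'cV[R]_n) : norm2 w <= r ->
  dot (y - proj_ball2 r y) (w - proj_ball2 r y) <= 0.
Proof.
move=> wr; rewrite /proj_ball2.
have [yr|ry] := leP (norm2 y) r.
  have [->|y0] := eqVneq y 0; first by rewrite !scaler0 subrr dot0l.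
  have yp : 0 < norm2 y.
    rewrite lt_def norm2_ge0 andbT; apply: contra_neq y0 => y0.
    by apply: dot_eq0; rewrite -sqr_norm2 y0 expr0n.
  by rewrite min_l ?ler_pdivlMr ?mul1r// scale1r subrr dot0l.
have r0 : 0 <= r := le_trans (norm2_ge0 w) wr.
have yp : 0 < norm2 y := le_lt_trans r0 ry.
rewrite min_r; last by rewrite ler_pdivrMr// mul1r ltW.
set c := r / _.
have c1 : c <= 1 by rewrite ler_pdivrMr// mul1r ltW.
have cE : c * norm2 y = r by rewrite /c divfK// gt_eqF.
have -> : y - c *: y = (1 - c) *: y by rewrite scalerBl scale1r.
rewrite dotZl; apply: mulr_ge0_le0; first by rewrite subr_ge0.
rewrite dotDr dotNr dotZr -sqr_norm2 expr2 mulrA cE.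
have := cauchy_schwarz y w; have := ler_wpM2l (ltW yp) wr; lra.
Qed.

End Euclidean.

(** * Extrema and Rayleigh quotients *)

Section Extrema.
Variable R : realType.

Lemma trmx_continuous m n : continuous (@trmx R m n).
Proof.
move=> x P [F Fx FP]; exists (fun i j => F j i) => [i j|y yF].
  by have := Fx j i; rewrite mxE.
by apply: FP => i j; rewrite mxE.
Qed.

(** Transposition carries the compactness criterion for row vectors over to columns. *)
Lemma bounded_closed_compact_cV n (A : set 'cV[R]_n) (b : R) :
  (forall x i, A x -> `|x i 0| <= b) -> closed A -> compact A.
Proof.
move=> Ab Acl.
have -> : A = trmx @` [set v : 'rV[R]_n | A v^T].
  rewrite predeqE => x; split => [Ax|[v Av <-]//].
  by exists x^T; rewrite /= trmxK.
apply: continuous_compact.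
  by apply: continuous_subspaceT; exact: trmx_continuous.
apply: bounded_closed_compact; last first.
  by apply: preimage_closed => // x _; exact: trmx_continuous.
exists (Num.max 0 b); split; first by rewrite num_real.
move=> M bM v Av.
have M0 : 0 <= M by rewrite (le_trans _ (ltW bM))// le_max lexx.
rewrite /= [leLHS]/Num.norm /= mx_normrE; apply: bigmax_le => // -[i j] _ /=.
rewrite ord1; have := Ab _ j Av; rewrite mxE => /le_trans; apply.
by rewrite (le_trans _ (ltW bM))// le_max lexx orbT.
Qed.

Lemma continuous_sumR (T : topologicalType) (I : Type) (r : seq I)
    (F : I -> T -> R) :
  (forall i, continuous (F i)) -> continuous (fun x => \sum_(i <- r) F i x).
Proof.
move=> Fc; elim: r => [|i r IH] x.
  by under eq_fun do rewrite big_nil; exact: cvg_cst.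
by under eq_fun do rewrite big_cons; apply: cvgD; [exact: Fc|exact: IH].
Qed.

Lemma dot_continuous (T : topologicalType) n (f g : T -> 'cV[R]_n) :
  (forall i, continuous (fun t => f t i 0)) ->
  (forall i, continuous (fun t => g t i 0)) ->
  continuous (fun t => dot (f t) (g t)).
Proof.
move=> fc gc; apply: continuous_sumR => i t.
by apply: cvgM; [exact: fc|exact: gc].
Qed.

Lemma mulmx_coord_continuous m n (A : 'M[R]_(m, n)) i :
  continuous (fun x : 'cV[R]_n => (A *m x) i 0).
Proof.
under eq_fun do rewrite mxE.
apply: continuous_sumR => k x.
exact: (continuousM (@cst_continuous _ _ _ x) (@coord_continuous R n 1 k 0 x)).
Qed.

(* The first-order term dominates as [t] tends to [0]. *)
Lemma first_order_le0 (a b : R) :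
  (forall t, 0 < t < 1 -> t * a <= t ^+ 2 * b) -> a <= 0.
Proof.
move=> h; rewrite leNgt; apply/negP => a0.
have b0 := normr_ge0 b.
have d0 : 0 < 2 * (`|b| + a) by lra.
have t01 : 0 < a / (2 * (`|b| + a)) < 1.
  by rewrite divr_gt0//= ltr_pdivrMr//; lra.
have := h _ t01; move: t01 => /andP[t0 _].
rewrite expr2 -mulrA ler_pM2l// mulrAC ler_pdivlMr//.
have := ler_norm b; nra.
Qed.

(** A maximizer v of x.Ax on the unit sphere, with value c, gives the bound by homogeneity. It is an
    eigenvector: with w = c v - A v, the bound at v - t w reads 2 t |w|^2 <= t^2 (c |w|^2 - w.Aw),
    which forces w = 0. *)
Lemma rayleigh_attained n (A : 'M[R]_n) : (0 < n)%N -> A^T = A ->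
  exists c, eigenvalue A c /\ forall x, dot x (A *m x) <= c * dot x x.
Proof.
move=> n0 AT.
have [v v1 vmax] : exists2 v, v \in [set x : 'cV[R]_n | dot x x = 1] &
    forall x, x \in [set x : 'cV[R]_n | dot x x = 1] ->
    dot x (A *m x) <= dot v (A *m v).
  apply: (@compact_EVT_max _ R (fun x => dot x (A *m x))).
  - exists (delta_mx (Ordinal n0) 0); rewrite /= /dot (bigD1 (Ordinal n0))//=.
    rewrite big1 ?addr0 ?mxE ?eqxx ?mulr1// => i.
    by rewrite !mxE => /negbTE ->; rewrite mul0r.
  - apply: (@bounded_closed_compact_cV _ _ 1) => [x i /= x1|].
      rewrite -(@ler_sqr _ _ 1) ?nnegrE// expr1n real_normK ?num_real//.
      rewrite -x1 /dot (bigD1 i)//= expr2 lerDl.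
      by apply: sumr_ge0 => j _; rewrite -expr2 sqr_ge0.
    apply: (@preimage_closed _ _ (fun x => dot x x) [set 1]); last exact: closed_eq.
    by move=> x _; apply: dot_continuous => i; exact: coord_continuous.
  - apply: continuous_subspaceT; apply: dot_continuous => i.
      exact: coord_continuous.
    exact: mulmx_coord_continuous.
rewrite inE /= in v1; set c := dot v _ in vmax; exists c.
have le_c x : dot x (A *m x) <= c * dot x x.
  have [->|x0] := eqVneq x 0; first by rewrite !dot0l mulr0.
  have xx : 0 < dot x x.
    rewrite lt_def dot_ge0 andbT; apply: contra_neq x0; exact: dot_eq0.
  have nx : 0 < norm2 x by rewrite sqrtr_gt0.
  have := vmax ((norm2 x)^-1 *: x); rewrite inE /=.
  rewrite -scalemxAr !dotZl !dotZr !mulrA -expr2 exprVn sqr_norm2 mulVf ?gt_eqF//.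
  by move=> /(_ erefl); rewrite mulrC ler_pdivrMr.
split=> //; have [w wE] : exists w, w = c *: v - A *m v by eexists.
have wAv : dot w (A *m v) = c * dot w v - dot w w.
  by rewrite -dotZr -dotNr -dotDr {3}wE opprB addrC subrK.
have vAw : dot v (A *m w) = dot w (A *m v) by rewrite -{1}AT -dot_mulmxl dotC.
have w0 : w = 0.
  apply: dot_eq0; apply/eqP; rewrite eq_le dot_ge0 andbT.
  have : 2 * dot w w <= 0; last by lra.
  apply: (@first_order_le0 _ (c * dot w w - dot w (A *m w))) => t _.
  have := le_c (v - t *: w).
  rewrite mulmxDr mulmxN -scalemxAr !dotE v1 vAw wAv (dotC v w) -/c; lra.
apply/eigenvalueP; exists v^T.
  rewrite -{1}AT -trmx_mul -linearZ; congr trmx.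
  by apply/eqP; rewrite eq_sym -subr_eq0 -wE w0.
apply: contraTneq (@oner_neq0 R) => /(congr1 trmx); rewrite trmxK trmx0 => v0.
by rewrite -v1 v0 dot0l eqxx.
Qed.

(** [eigenvalue] speaks of row vectors; symmetry allows the passage to columns. *)
Lemma eigenvalue_cV n (A : 'M[R]_n) a : A^T = A -> eigenvalue A a ->
  exists2 v : 'cV[R]_n, 0 < dot v v & A *m v = a *: v.
Proof.
move=> AT /eigenvalueP[v vA v0]; exists v^T.
  rewrite lt_def dot_ge0 andbT; apply: contra_neq v0 => /dot_eq0.
  by move=> /(congr1 trmx); rewrite trmxK trmx0.
by rewrite -{1}AT -trmx_mul vA linearZ.
Qed.

Lemma le_lambda_max n (A : 'M[R]_n) x : (0 < n)%N -> A^T = A ->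
  dot x (A *m x) <= lambda_max A * dot x x.
Proof.
move=> n0 AT; have [c [Ac le_c]] := rayleigh_attained n0 AT.
apply: (le_trans (le_c x)); apply: ler_wpM2r; first exact: dot_ge0.
apply: ub_le_sup => //; exists c => a /= /(eigenvalue_cV AT)[v v0 Av].
by have := le_c v; rewrite Av dotZr ler_pM2r.
Qed.

(** Negating the matrix negates its eigenvalues, so that lower bounds by [lambda_min] reduce to
    upper bounds by [lambda_max]. *)
Lemma lambda_inf_attained n (A : 'M[R]_n) : lambda_min A = - lambda_max (- A).
Proof.
rewrite /lambda_min /lambda_max /inf; congr (- sup _).
have eN (B : 'M[R]_n) a : eigenvalue B a -> eigenvalue (- B) (- a).
  move=> /eigenvalueP[v vB v0]; apply/eigenvalueP; exists v => //.
  by rewrite mulmxN vB scaleNr.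
rewrite predeqE => a; split => [[b /= /eN ? <-]//|/= /eN].
by rewrite opprK => ?; exists (- a) => //; rewrite opprK.
Qed.

Lemma lambda_min_le n (A : 'M[R]_n) x : (0 < n)%N -> A^T = A ->
  lambda_min A * dot x x <= dot x (A *m x).
Proof.
move=> n0 AT; have := @le_lambda_max _ (- A) x n0.
rewrite lambda_inf_attained mulNmx dotNr linearN /= AT => /(_ erefl); lra.
Qed.

Lemma lambda_min_ge0 n (A : 'M[R]_n) : (0 < n)%N -> A^T = A ->
  (forall x, 0 <= dot x (A *m x)) -> 0 <= lambda_min A.
Proof.
move=> n0 AT A0; apply: lb_le_inf.
  by have [c [Ac _]] := rayleigh_attained n0 AT; exists c.
move=> a /= /(eigenvalue_cV AT)[v v0 Av].
by have := A0 v; rewrite Av dotZr pmulr_lge0.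
Qed.

End Extrema.

(** * Gram matrices and the operator norm from l1 to l2 *)

Section OperatorNorm.
Variables (R : realType) (m n : nat) (B : 'M[R]_(m, n)).
Hypothesis n_gt0 : (0 < n)%N.

Lemma trmx_gram : (B^T *m B)^T = B^T *m B.
Proof. by rewrite trmx_mul trmxK. Qed.

Lemma dot_gram x : dot x (B^T *m B *m x) = dot (B *m x) (B *m x).
Proof. by rewrite -mulmxA -dot_mulmxl. Qed.

Lemma gram_le_lambda_max x :
  dot (B *m x) (B *m x) <= lambda_max (B^T *m B) * dot x x.
Proof. by rewrite -dot_gram; apply: le_lambda_max => //; exact: trmx_gram. Qed.

Lemma lambda_min_le_gram x :
  lambda_min (B^T *m B) * dot x x <= dot (B *m x) (B *m x).
Proof. by rewrite -dot_gram; apply: lambda_min_le => //; exact: trmx_gram. Qed.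

Lemma lambda_min_gram_ge0 : 0 <= lambda_min (B^T *m B).
Proof.
apply: lambda_min_ge0 => // [|x]; first exact: trmx_gram.
by rewrite dot_gram dot_ge0.
Qed.

Lemma lambda_max_gram_ge0 : 0 <= lambda_max (B^T *m B).
Proof.
have := gram_le_lambda_max (delta_mx (Ordinal n_gt0) 0).
have -> : dot (delta_mx (Ordinal n_gt0) 0) (delta_mx (Ordinal n_gt0) 0) = 1 :> R.
  rewrite /dot (bigD1 (Ordinal n_gt0))//= big1 => [|i /negbTE i0].
    by rewrite !mxE !eqxx mulr1 addr0.
  by rewrite !mxE i0 mul0r.
by rewrite mulr1; exact: le_trans (dot_ge0 _).
Qed.

(** The set under the supremum is bounded by sqrt ([lambda_max]), because |y|_2^2 <= |y|_1 when
    |y|_1 <= 1. *)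
Lemma norm2_le_norm12 x : norm1 x <= 1 -> norm2 (B *m x) <= norm12 B.
Proof.
move=> x1; apply: ub_le_sup; last by exists x.
exists (Num.sqrt (lambda_max (B^T *m B))) => _ [y /= y1 <-].
apply: ler_wsqrtr; apply: (le_trans (gram_le_lambda_max y)).
rewrite -[leRHS]mulr1; apply: ler_wpM2l; first exact: lambda_max_gram_ge0.
apply: (le_trans _ y1); apply: ler_sum => i _.
rewrite -expr2 -real_normK ?num_real// expr2 ler_piMr//.
apply: (le_trans _ y1); rewrite /norm1 (bigD1 i)//= lerDl.
by apply: sumr_ge0 => j _.
Qed.

Lemma norm12_ge0 : 0 <= norm12 B.
Proof.
have := @norm2_le_norm12 0; rewrite mulmx0 norm20; apply.
by rewrite /norm1 big1 => [|i _]; rewrite ?mxE ?normr0.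
Qed.

End OperatorNorm.

(** * Strong convexity of the negative entropy *)

Section Entropy.
Variable R : realType.
Implicit Types a b c t x : R.

Lemma ln_tangent a b : 0 < a -> 0 < b -> ln b <= ln a + (b - a) / a.
Proof.
move=> a0 b0; have ba : 0 < b / a by rewrite divr_gt0.
have := @le_ln1Dx R (b / a - 1); rewrite (addrC 1) subrK ln_div ?posrE//.
have -> : (b - a) / a = b / a - 1 by rewrite mulrBl divff// gt_eqF.
by move=> h; have := h _; lra.
Qed.

(** Left of 0 the product vanishes because [ln] does. Right of 0, with s = sqrt y, the tangent
    inequality 1 - 1/s <= ln s gives -y ln y <= 2 (s - s^2) <= 2 s, hence the threshold (e /
    2)^2. *)
Lemma continuous_xlnx : continuous (fun x : R => x * ln x).
Proof.
move=> x; have [x0|x0|->] := ltgtP x 0.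
- apply/cvgrPdist_le => /= e e0; near=> y.
  have y0 : y < 0 by near: y; exact: lt_nbhsl.
  by rewrite (ln0 (ltW x0)) (ln0 (ltW y0)) !mulr0 subrr normr0; exact: ltW.
- by apply: continuousM; [exact: cvg_id|exact: continuous_ln].
- apply/cvgrPdist_le => /= e e0; near=> y.
  rewrite mul0r sub0r normrN.
  have [y0|y0] := leP y 0; first by rewrite ln0// mulr0 normr0 ltW.
  have y1 : y <= 1 by near: y; exact: lt_le_nbhsl.
  have ye : y <= (e / 2) ^+ 2.
    by near: y; apply: lt_le_nbhsl; rewrite exprn_gt0// divr_gt0.
  have s0 : 0 < Num.sqrt y by rewrite sqrtr_gt0.
  have se : Num.sqrt y <= e / 2.
    by rewrite -(@ler_sqr _ _ (e / 2)) ?nnegrE ?sqr_sqrtr// ltW// divr_gt0.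
  rewrite ler0_norm ?mulr_ge0_le0 ?ln_le0 ?(ltW y0)//.
  have := ln_tangent s0 (@ltr01 R); rewrite ln1 mulrBl mul1r divff ?gt_eqF// => h.
  have yE := sqr_sqrtr (ltW y0).
  move: s0 se h yE; set s := Num.sqrt y; move: s => s s0 se h <-.
  rewrite lnXn// -mulr_natr.
  have := ler_wpM2l (sqr_ge0 s) h.
  rewrite mulr0 mulrDr mulrBr expr2 mulfK ?gt_eqF//.
  by have := mulr_ge0 (ltW s0) (ltW s0); lra.
Unshelve. all: by end_near. Qed.

(* [x ln x - x^2 / 2] lies above its tangents on [0, 1]. *)
Lemma xlnx_tangent c x : 0 < c <= 1 -> 0 <= x <= 1 ->
  c * ln c + (1 + ln c) * (x - c) + 2^-1 * (x - c) ^+ 2 <= x * ln x.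
Proof.
move=> /andP[c0 c1] /andP[]; rewrite le0r => /orP[/eqP -> _|x0 x1].
  rewrite mul0r; have : c ^+ 2 <= c by rewrite expr2 ler_piMr// ltW.
  lra.
(* Up to a constant [g] is the difference of the two sides. Its derivative [dg] has the sign of y -
   c, because ln has slope at least 1 on ]0, 1]; so [g] is least at c. *)
pose g y : R := y * ln y - (1 + ln c) * y - 2^-1 * (y - c) ^+ 2.
pose dg y : R := ln y - ln c - (y - c).
have gd (y : R) : 0 < y -> is_derive y 1 g (dg y).
  move=> y0; have ? := is_derive1_ln y0.
  apply: is_derive_eq; rewrite /GRing.scale /= /dg.
  field; rewrite gt_eqF//.
have gc (a b : R) : 0 < a -> {within `[a, b], continuous g}.
  move=> a0; apply: derivable_within_continuous => y; rewrite in_itv /=.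
  by move=> /andP[ay _]; have [] := gd y (lt_le_trans a0 ay).
suff : g c <= g x by rewrite /g; lra.
have [xc|cx|<-//] := ltgtP x c.
  have gd' (y : R) : y \in `]x, c[%R -> is_derive y 1 g (dg y).
    by rewrite in_itv /= => /andP[xy _]; exact: gd (lt_trans x0 xy).
  have [y] := MVT xc gd' (gc _ _ x0).
  rewrite in_itv /= => /andP[xy yc] h.
  have y0 := lt_trans x0 xy.
  have h1 := ln_tangent c0 y0.
  have h2 : (y - c) / c <= y - c.
    rewrite ler_pdivrMr//; nra.
  have dg0 : dg y <= 0 by rewrite /dg; lra.
  by rewrite -subr_le0 h mulr_le0_ge0// subr_ge0 ltW.
have gd' (y : R) : y \in `]c, x[%R -> is_derive y 1 g (dg y).
  by rewrite in_itv /= => /andP[cy _]; exact: gd (lt_trans c0 cy).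
have [y] := MVT cx gd' (gc _ _ c0).
rewrite in_itv /= => /andP[cy yx] h.
have y0 := lt_trans c0 cy.
have h1 := ln_tangent y0 c0.
have h2 : y - c <= (y - c) / y.
  rewrite ler_pdivlMr//; nra.
have dg0 : 0 <= dg y.
  by rewrite /dg; move: h1; rewrite -(opprB y c) mulNr; lra.
by rewrite -subr_ge0 h mulr_ge0// subr_ge0 ltW.
Qed.

(** The tangent inequality at the intermediate point c is averaged over a and b: the linear terms
    cancel and (1 - t) t^2 + t (1 - t)^2 = t (1 - t). If c = 0, then a = b = 0. *)
Lemma xlnx_strongly_convex t a b : 0 < t < 1 -> 0 <= a <= 1 -> 0 <= b <= 1 ->
  (a + t * (b - a)) * ln (a + t * (b - a)) <=
  (1 - t) * (a * ln a) + t * (b * ln b) - 2^-1 * (t * (1 - t) * (b - a) ^+ 2).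
Proof.
move=> /andP[t0 t1] a01 b01; set c := a + _.
have [/andP[a0 a1] /andP[b0 b1]] := (a01, b01).
have cE : c = (1 - t) * a + t * b by rewrite /c; ring.
have t1' : 0 < 1 - t by rewrite subr_gt0.
have c0 : 0 <= c by rewrite cE addr_ge0// mulr_ge0// ltW.
have c1 : c <= 1 by rewrite cE; nra.
move: c0; rewrite le0r => /orP[/eqP c0|c0].
  have ta0 : (1 - t) * a = 0 by have := mulr_ge0 (ltW t1') a0;
    have := mulr_ge0 (ltW t0) b0; lra.
  have tb0 : t * b = 0 by have := mulr_ge0 (ltW t1') a0;
    have := mulr_ge0 (ltW t0) b0; lra.
  have {ta0} -> : a = 0.
    by apply/eqP; move/eqP: ta0; rewrite mulf_eq0 gt_eqF.
  have {tb0} -> : b = 0.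
    by apply/eqP; move/eqP: tb0; rewrite mulf_eq0 gt_eqF.
  by rewrite c0; lra.
have c01 : 0 < c <= 1 by rewrite c0.
have ha := ler_wpM2l (ltW t1') (xlnx_tangent c01 a01).
have hb := ler_wpM2l (ltW t0) (xlnx_tangent c01 b01).
have ac : a - c = - t * (b - a) by rewrite /c; ring.
have bc : b - c = (1 - t) * (b - a) by rewrite /c; ring.
rewrite ac bc in ha hb; nra.
Qed.

End Entropy.

(** * Differentiability and the saddle-point objective *)

Lemma differentiable_littleo (R : numFieldType) (V W : normedModType R)
    (f : V -> W) (df : {linear V -> W}) x : continuous df ->
  f \o shift x = cst (f x) + df +o_ 0 id ->
  differentiable f x /\ 'd f x = df :> (V -> W).
Proof.
move=> dfc fo; have dE := diff_unique dfc fo.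
by split=> //; apply/diff_locallyP; rewrite dE.
Qed.

Section Differentiability.
Variables (R : realType) (n : nat) (g : 'cV[R]_n -> R) (x a : 'cV[R]_n) (c : R).
Hypothesis quadratic_error : forall y,
  `|g y - g x - dot a (y - x)| <= c * dot (y - x) (y - x).

(** Here [|y|] is the sup norm, in which the little-o of the differential is measured. *)
Lemma dot_le_mx_norm (y : 'cV[R]_n) : dot y y <= n%:R * `|y| ^+ 2.
Proof.
rewrite -[n in n%:R]card_ord mulr_natl -sumr_const /dot.
apply: ler_sum => i _; rewrite -expr2 -real_normK ?num_real//.
rewrite ler_sqr ?nnegrE// [leRHS]/Num.norm /= mx_normrE.
by apply/bigmax_geP; right; exists (i, 0).
Qed.

Lemma quadratic_error_diff : differentiable g x /\ forall v, 'd g x v = dot a v.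
Proof.
have alin : linear (dot a : 'cV[R]_n -> R^o).
  by move=> t y w; rewrite dotDr dotZr.
pose aM := GRing.isLinear.Build _ _ _ _ _ alin.
pose aL : {linear 'cV[R]_n -> R^o} := HB.pack (dot a : 'cV[R]_n -> R^o) aM.
have ac : continuous aL.
  apply: dot_continuous => i; first exact: cst_continuous.
  exact: coord_continuous.
have [//|gx dE] := @differentiable_littleo R 'cV[R]_n R^o g aL x ac.
  apply/eqaddoP => e e0.
  have d0 : 0 <= `|c| * n%:R by rewrite mulr_ge0.
  have de : 0 < e / (`|c| * n%:R + 1) by rewrite divr_gt0// ltr_wpDl.
  apply: filterS (nbhs0_le de) => y yd.
  rewrite /= !fctE /=.
  have := quadratic_error (y + x); rewrite addrK opprD addrA => /le_trans; apply.
  have c0 : c <= `|c| by exact: ler_norm.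
  apply: (@le_trans _ _ (`|c| * (n%:R * `|y| ^+ 2))).
    by apply: (le_trans (ler_wpM2r (dot_ge0 y) c0)); apply: ler_wpM2l => //;
      exact: dot_le_mx_norm.
  rewrite expr2 !mulrA; apply: ler_wpM2r => //.
  move: yd; rewrite ler_pdivlMr; [have := normr_ge0 y; nra|lra].
by split=> [//|v]; rewrite dE.
Qed.

Lemma quadratic_error_grad : grad g x = a.
Proof.
have [gx gE] := quadratic_error_diff.
apply/matrixP => i j; rewrite ord1 mxE deriveE// gE /dot (bigD1 i)//=.
rewrite big1 => [|l li]; first by rewrite mxE !eqxx mulr1 addr0.
by rewrite mxE (negbTE li) mulr0.
Qed.

End Differentiability.

Lemma inf_attained (R : realType) (A : set R) m : A m -> lbound A m -> inf A = m.
Proof.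
move=> Am lbm; apply/eqP; rewrite eq_le ge_inf ?lb_le_inf//; exists m => //.
Qed.

Lemma sup_attained (R : realType) (A : set R) m : A m -> ubound A m -> sup A = m.
Proof.
by move=> Am ubm; apply/eqP; rewrite eq_le ge_sup ?ub_le_sup//; exists m.
Qed.

(** * Exchange of supremum and infimum in the objective *)

Section Objective.
Variables (R : realType) (k r0 r1 : nat) (K : set 'cV[R]_k).
Variables (B0 : 'M[R]_(r0, k)) (B1 : 'M[R]_(r1, k)) (eps : R).
Hypothesis eps_gt0 : 0 < eps.
Hypotheses (K_neq0 : K !=set0) (K_closed : closed K).
Hypothesis K_01 : forall x i, K x -> 0 <= x i 0 <= 1.
Hypothesis K_convex : forall x y t, K x -> K y -> 0 < t < 1 ->
  K (x + t *: (y - x)).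

Lemma entropy_strongly_concave x y t : K x -> K y -> 0 < t < 1 ->
  - entropy (x + t *: (y - x)) <= (1 - t) * - entropy x + t * - entropy y
    - 2^-1 * (t * (1 - t) * dot (y - x) (y - x)).
Proof.
move=> Kx Ky t01; rewrite /entropy /dot !opprK !mulr_sumr -sumrN -!big_split /=.
apply: ler_sum => i _; rewrite !mxE -expr2.
apply: xlnx_strongly_convex; rewrite ?K_01//.
Qed.

Lemma entropy_continuous : continuous (@entropy R k).
Proof.
have h : continuous (fun x : 'cV[R]_k => \sum_i x i 0 * ln (x i 0)).
  apply: continuous_sumR => i x.
  have c0 := @coord_continuous R k 1 i 0 x.
  exact: (continuous_comp c0 (@continuous_xlnx R _)).
by move=> x; exact: (continuousN (h x)).
Qed.

Lemma entropic_continuous (f : 'cV[R]_k -> R) : continuous f ->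
  continuous (fun x => f x - eps * entropy x).
Proof.
move=> fc x; apply: (continuousB (fc x)).
exact: (continuousM (@cst_continuous _ _ _ x) (@entropy_continuous x)).
Qed.

Lemma min_on_K (f : 'cV[R]_k -> R) : continuous f ->
  exists2 x, K x & forall y, K y -> f x <= f y.
Proof.
move=> fc; have Kc : compact K.
  apply: (@bounded_closed_compact_cV _ _ _ 1) => // x i /(@K_01 _ i) /andP[x0 x1].
  by rewrite ger0_norm.
have [x xK xmin] := compact_EVT_min K_neq0 Kc (continuous_subspaceT fc).
exists x => [|y yK]; first by rewrite inE in xK.
by apply: xmin; rewrite inE.
Qed.

(** The inner objective once v is eliminated: the supremum over v of v.(B1 x) - |v|^2/2 is |B1
    x|^2/2, attained at v = B1 x. *)
Let primal u x := 2^-1 * dot (B1 *m x) (B1 *m x) - dot u (B0 *m x)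
  - eps * entropy x.

Lemma primal_argmin : exists xs : 'cV[R]_r0 -> 'cV[R]_k,
  forall u, K (xs u) /\ forall y, K y -> primal u (xs u) <= primal u y.
Proof.
suff /boolp.choice[xs xsP] : forall u, exists x,
    K x /\ forall y, K y -> primal u x <= primal u y by exists xs.
move=> u.
have [|x Kx xmin] := @min_on_K (primal u); last by exists x.
apply: entropic_continuous => x.
have c1 : continuous (fun x => dot (B1 *m x) (B1 *m x)).
  by apply: dot_continuous => i; exact: mulmx_coord_continuous.
have c0 : continuous (fun x => dot u (B0 *m x)).
  apply: dot_continuous => i; first exact: cst_continuous.
  exact: mulmx_coord_continuous.
exact: (continuousB (continuousM (@cst_continuous _ _ _ x) (c1 x)) (c0 x)).
Qed.

(** First-order optimality along x + t (y - x). The entropy enters through its values, not its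
    gradient, as ln is singular on the boundary; its strong concavity yields the left-hand side. *)
Lemma primal_argmin_vi u x y : K x -> (forall y, K y -> primal u x <= primal u y) ->
  K y ->
  eps / 2 * dot (y - x) (y - x) <=
  dot (B1 *m x) (B1 *m (y - x)) - dot u (B0 *m (y - x))
  - eps * entropy y + eps * entropy x.
Proof.
move=> Kx xmin Ky; rewrite -subr_le0.
apply: (@first_order_le0 _ _ (2^-1 * dot (B1 *m (y - x)) (B1 *m (y - x))
  + eps / 2 * dot (y - x) (y - x))) => t t01.
have := xmin _ (K_convex Kx Ky t01).
have /(ler_wpM2l (ltW eps_gt0)) := entropy_strongly_concave Kx Ky t01.
rewrite /primal; move: (y - x) => d; set e := entropy (x + _).
rewrite !mulmxDr -!scalemxAr !dotE (dotC (B1 *m d)); lra.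
Qed.

Lemma inner_dot u (v : 'cV[R]_r1) x :
  dot (B1^T *m v - B0^T *m u) x = dot v (B1 *m x) - dot u (B0 *m x).
Proof. by rewrite dotDl dotNl !dot_mulmxl !trmxK. Qed.

(** (B1 x, x) is a saddle point. At v = B1 x the variational inequality makes x a minimizer of the
    inner problem too; for any other v, the inner infimum is at most its value at x, and |v - B1
    x|^2 >= 0 concludes. *)
Lemma objectiveE u x : K x -> (forall y, K y -> primal u x <= primal u y) ->
  objective K B0 B1 eps u = 2^-1 * norm2 u ^+ 2 + primal u x.
Proof.
move=> Kx xmin; congr (_ + _).
pose inner v y := dot (B1^T *m v - B0^T *m u) y - eps * entropy y.
have innerE v : exists2 y, K y & inf [set inner v y | y in K] = inner v y /\
    forall w, K w -> inner v y <= inner v w.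
  have [|y Ky ymin] := @min_on_K (inner v).
    apply: entropic_continuous; apply: dot_continuous => i.
      exact: cst_continuous.
    exact: coord_continuous.
  exists y => //; split => //; apply: inf_attained; first by exists y.
  by move=> _ [w Kw <-]; exact: ymin.
apply: sup_attained.
  exists (B1 *m x) => //.
  have -> : inf [set inner (B1 *m x) y | y in K] = inner (B1 *m x) x.
    apply: inf_attained; first by exists x.
    move=> _ [y Ky <-]; rewrite /inner !inner_dot.
    have := primal_argmin_vi Kx xmin Ky.
    have : 0 <= eps / 2 * dot (y - x) (y - x).
      by rewrite mulr_ge0 ?dot_ge0// divr_ge0// ltW.
    rewrite !mulmxBr [dot u (_ - _)]dotDr [dot _ (B1 *m y - _)]dotDr !dotNr; lra.
  rewrite /inner inner_dot sqr_norm2 /primal; lra.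
move=> _ [v _ <-]; have [y Ky [-> ymin]] := innerE v.
have := ymin _ Kx; rewrite /inner !inner_dot /primal sqr_norm2.
have := dot_ge0 (v - B1 *m x); rewrite !dotE (dotC (B1 *m x) v); lra.
Qed.

Variables (lmax lmin : R).
Hypotheses (lmax_ge : forall x, dot (B0 *m x) (B0 *m x) <= lmax * dot x x).
Hypotheses (lmin_le : forall x, lmin * dot x x <= dot (B1 *m x) (B1 *m x)).
Hypotheses (lmin_ge0 : 0 <= lmin) (lmax_ge0 : 0 <= lmax).
Let rho := lmax / (lmin + eps).

(** The second claim uses x_u as a competitor in the problem of w. For the third, the variational
    inequalities at x_u and x_w are added: the entropies cancel, leaving (lmin + eps) |d|^2 <= (u -
    w).(B0 d) for d = x_u - x_w, while |B0 d|^2 <= lmax |d|^2. *)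
Lemma objective_structure : exists F : 'cV[R]_r0 -> 'cV[R]_r0,
  [/\ forall u, exists2 x, K x & F u = B0 *m x,
      forall u w, objective K B0 B1 eps w - 2^-1 * norm2 w ^+ 2 <=
        objective K B0 B1 eps u - 2^-1 * norm2 u ^+ 2 - dot (w - u) (F u) &
      forall u w, dot (F u - F w) (F u - F w) <= rho * dot (u - w) (F u - F w)].
Proof.
have [xs xsP] := primal_argmin.
exists (fun u => B0 *m xs u); split => [u|u w|u w].
- by have [Kx _] := xsP u; exists (xs u).
- have [[Ku umin] [Kw wmin]] := (xsP u, xsP w).
  rewrite (objectiveE Ku umin) (objectiveE Kw wmin).
  have := wmin _ Ku; rewrite /primal dotDl dotNl; lra.
have [[Ku umin] [Kw wmin]] := (xsP u, xsP w).
have hu := primal_argmin_vi Ku umin Kw; have hw := primal_argmin_vi Kw wmin Ku.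
rewrite -mulmxBr; set d := xs u - xs w.
have dN : xs w - xs u = - d by rewrite opprB.
rewrite dN mulmxN !dotNr dotNl opprK in hu; rewrite -/d mulmxN in hu hw.
rewrite !dotNr in hu; rewrite -/d in hw.
have h : (lmin + eps) * dot d d <= dot (u - w) (B0 *m d).
  have := lmin_le d; have -> : dot (B1 *m d) (B1 *m d) =
     dot (B1 *m xs u) (B1 *m d) - dot (B1 *m xs w) (B1 *m d).
    by rewrite -dotNl -dotDl -mulmxBr.
  rewrite dotDl dotNl; lra.
have le0 : 0 < lmin + eps by rewrite ltr_wpDl.
apply: (le_trans (lmax_ge d)); rewrite /rho mulrAC ler_pdivlMr// -mulrA.
by apply: ler_wpM2l => //; rewrite mulrC.
Qed.

End Objective.

(** * Smoothness and curvature bounds for the objective *)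

Section SmoothPart.
Variables (R : realType) (n : nat) (rho : R).
Variables (ell : 'cV[R]_n -> R) (F : 'cV[R]_n -> 'cV[R]_n).
Let f u := ell u - 2^-1 * norm2 u ^+ 2.
Hypothesis rho_ge0 : 0 <= rho.
Hypothesis f_concave : forall u w, f w <= f u - dot (w - u) (F u).
Hypothesis F_cocoercive : forall u w,
  dot (F u - F w) (F u - F w) <= rho * dot (u - w) (F u - F w).

Lemma F_monotone u w : 0 <= dot (u - w) (F u - F w).
Proof.
have := f_concave u w; have := f_concave w u; rewrite !dotE; lra.
Qed.

Lemma F_lipschitz : lipschitz2 F rho.
Proof.
move=> u w; have := norm2_ge0 (F u - F w); rewrite le0r => /orP[/eqP ->|F0].
  by rewrite mulr_ge0 ?norm2_ge0.
rewrite -(ler_pM2r F0) -expr2 sqr_norm2; apply: (le_trans (F_cocoercive u w)).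
by rewrite -mulrA; apply: ler_wpM2l => //; exact: cauchy_schwarz.
Qed.

(* Expanding the square, cocoercivity bounds the left-hand side by
   [|u - w|^2 + (1 - 2 / rho) |F u - F w|^2]. *)
Lemma id_sub_F_lipschitz :
  lipschitz2 (fun u => u - F u) (Num.max 1 (rho - 1)).
Proof.
move=> u w; have L0 : 0 <= Num.max 1 (rho - 1) by rewrite le_max ler01.
rewrite norm2_le ?mulr_ge0 ?norm2_ge0// exprMn sqr_norm2.
have -> : u - F u - (w - F w) = (u - w) - (F u - F w).
  by apply/matrixP => i j; rewrite !mxE; ring.
have := F_lipschitz u w.
rewrite norm2_le ?mulr_ge0 ?norm2_ge0// exprMn sqr_norm2.
have := F_cocoercive u w; have := F_monotone u w.
move: (u - w) (F u - F w) => d e; rewrite !dotE (dotC e d) => h0 h1 h2.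
have d0 := dot_ge0 d; have e0 := dot_ge0 e.
(* For rho <= 2, |e|^2 - 2 d.e <= (rho - 2) d.e <= 0. Otherwise |e| <= rho |d| is inserted, and 1 +
   (1 - 2 / rho) rho^2 = (rho - 1)^2. *)
have [r2|r2] := leP rho 2.
  have : 1 <= Num.max 1 (rho - 1) ^+ 2 by rewrite exprn_ege1// le_max lexx.
  move=> /(ler_wpM2r d0); rewrite mul1r => /(le_trans _); apply.
  have := mulr_ge0 h0 (_ : 0 <= 2 - rho); rewrite subr_ge0 => /(_ r2); lra.
have rho0 : 0 < rho by lra.
rewrite max_r; last by lra.
rewrite -(ler_pM2l rho0).
have r2' : 0 <= rho - 2 by lra.
have := ler_wpM2l r2' h2; lra.
Qed.

(** Concavity with the roles of u and w exchanged, where F w is replaced by F u at the cost of the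
    Lipschitz bound. The constant rho instead of rho / 2 suffices for differentiability and to start
    the bisection in [f_lower_lipschitz]. *)
Lemma f_lower u w :
  f u - dot (w - u) (F u) - rho * dot (w - u) (w - u) <= f w.
Proof.
have := f_concave w u.
have -> : u - w = - (w - u) by rewrite opprB.
have := F_lipschitz w u; have := cauchy_schwarz (w - u) (F w - F u).
move=> h1 /(ler_wpM2l (norm2_ge0 (w - u))) /(le_trans h1).
rewrite mulrCA -expr2 sqr_norm2 dotDr !dotNr dotNl; lra.
Qed.

Lemma ellE u w : ell w - ell u - dot (u - F u) (w - u) =
  f w - f u + dot (w - u) (F u) + 2^-1 * dot (w - u) (w - u).
Proof.
rewrite /f !sqr_norm2 !dotE (dotC (F u) w) (dotC (F u) u) (dotC w u); lra.
Qed.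

Lemma ell_upper u w :
  ell w <= ell u + dot (u - F u) (w - u) + 2^-1 * dot (w - u) (w - u).
Proof. by have := f_concave u w; have := ellE u w; lra. Qed.

Lemma ell_diff u : differentiable ell u /\ grad ell u = u - F u.
Proof.
suff h y : `|ell y - ell u - dot (u - F u) (y - u)| <=
    (2^-1 + rho) * dot (y - u) (y - u).
  by split; [have [] := quadratic_error_diff h|exact: quadratic_error_grad h].
have := f_concave u y; have := f_lower u y; have := dot_ge0 (y - u).
rewrite ellE => D0 h1 h2.
have := mulr_ge0 rho_ge0 D0; rewrite ler_norml => ?; lra.
Qed.

Lemma f_grad u : grad f u = - F u.
Proof.
apply: (@quadratic_error_grad _ _ _ _ _ rho) => y.
have := f_concave u y; have := f_lower u y; have := dot_ge0 (y - u).
rewrite dotNl opprK (dotC (F u)) => D0 h1 h2.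
have := mulr_ge0 rho_ge0 D0; rewrite ler_norml => ?; lra.
Qed.

(** A unit gradient step from u leads to F u and lowers [ell] by at least |u - F u|^2 / 2. *)
Lemma ell_minimizer u : is_minimizer ell u -> F u = u.
Proof.
move=> /(_ (F u)); have := ell_upper u (F u).
have -> : F u - u = - (u - F u) by rewrite opprB.
rewrite !dotNr dotNl; have := dot_ge0 (u - F u) => h1 h2 h3.
have /dot_eq0/eqP : dot (u - F u) (u - F u) = 0 by lra.
by rewrite subr_eq0 => /eqP.
Qed.

(** Convexity on the segment is compared with [f_lower], whose error is of second order in t. *)
Lemma ell_convex_lower : convex ell ->
  forall u w, ell u + dot (u - F u) (w - u) <= ell w.
Proof.
move=> ell_cvx u w; rewrite -subr_le0.
apply: (@first_order_le0 _ _ (rho * dot (w - u) (w - u))) => t /andP[t0 t1].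
have := ell_cvx (Itv01 (ltW t0) (ltW t1)) w u (in_setT _) (in_setT _).
have -> : conv (Itv01 (ltW t0) (ltW t1)) (w : convex_lmodType 'cV[R]_n) u =
    u + t *: (w - u).
  rewrite /conv /= /unstable.onem scalerBr scalerBl scale1r addrCA.
  by congr (_ + _); rewrite addrC.
rewrite convRE /= /unstable.onem.
have := f_lower u (u + t *: (w - u)); have := ellE u (u + t *: (w - u)).
have -> : u + t *: (w - u) - u = t *: (w - u) by rewrite addrC addKr.
have := dot_ge0 (t *: (w - u)).
rewrite !(dotZl, dotZr); nra.
Qed.

Lemma le0_of_geometric (a b : R) : (forall m, a <= b / 2 ^+ m) -> a <= 0.
Proof.
move=> h; rewrite leNgt; apply/negP => a0.
have b0 : 0 <= b by have := h 0%N; rewrite expr0 divr1; lra.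
have := archi_boundP (divr_ge0 b0 (ltW a0)).
set m := Num.bound _ => bm.
have := h m; rewrite ler_pdivlMr ?exprn_gt0// leNgt => /negP; apply.
rewrite mulrC -ltr_pdivrMr//; apply: (lt_trans bm).
by rewrite -natrX ltr_nat ltn_expl.
Qed.

(* Halving the segment turns a lower curvature bound [c] into
   [c / 2 + L' / 4], whose iterates tend to [L' / 2]. *)
Lemma f_lower_lipschitz L' : lipschitz2 (grad f) L' ->
  forall u w, f u - dot (w - u) (F u) - L' / 2 * dot (w - u) (w - u) <= f w.
Proof.
move=> f_lip.
have h m : forall u w, f u - dot (w - u) (F u)
    - (L' / 2 + (rho - L' / 2) / 2 ^+ m) * dot (w - u) (w - u) <= f w.
  elim: m => [|m IH] u w.
    have -> : L' / 2 + (rho - L' / 2) / 2 ^+ 0 = rho by rewrite expr0; lra.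
    exact: f_lower.
  (* The induction hypothesis is applied on both halves; replacing F (u + d) by F u costs L' |d|^2 =
     L' / 4 * |w - u|^2. *)
  pose d := 2^-1 *: (w - u); have dE : w - u = 2 *: d.
    by rewrite /d scalerA divff ?scale1r.
  have := IH u (u + d); have := IH (u + d) w.
  have -> : w - (u + d) = d.
    by rewrite opprD addrA dE scaler_nat mulr2n addrK.
  have -> : u + d - u = d by rewrite addrC addKr.
  have := f_lip (u + d) u; rewrite !f_grad.
  have -> : - F (u + d) - - F u = - (F (u + d) - F u) by rewrite opprB addrC opprK.
  rewrite norm2N addrAC subrr add0r => hF.
  have hd := le_trans (cauchy_schwarz d (F (u + d) - F u))
    (ler_wpM2l (norm2_ge0 d) hF).
  move: hd; rewrite mulrCA -expr2 sqr_norm2 dE exprS invfM !dotE.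
  set q' := (rho - _) / 2 ^+ m; set q := (rho - _) * _ => hd h1 h2.
  have -> : q = 2^-1 * q' by rewrite /q /q'; ring.
  lra.
move=> u w; rewrite -subr_le0.
apply: (@le0_of_geometric _ ((rho - L' / 2) * dot (w - u) (w - u))) => m.
by have := h m u w; rewrite mulrAC; lra.
Qed.

(** A negative Lipschitz constant would force any two points to coincide, and then [ell] would be
    convex. *)
Lemma nonconvex_lipschitz_ge0 L' : ~ convex ell -> lipschitz2 (grad f) L' ->
  0 <= L'.
Proof.
move=> ncvx f_lip; rewrite leNgt; apply/negP => L0; apply: ncvx => t u w _ _.
have -> : w = u.
  apply/eqP; rewrite eq_sym -subr_eq0; apply/eqP/dot_eq0; rewrite -sqr_norm2.
  have := le_trans (norm2_ge0 _) (f_lip u w).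
  have := norm2_ge0 (u - w); move: (norm2 _) => r r0.
  by rewrite nmulr_rge0// => r0'; rewrite (le_anti (introT andP (conj r0' r0))) expr0n.
by rewrite !convmm.
Qed.

End SmoothPart.

(** * Couplings *)

Section CouplingPolytope.
Variables (R : realType) (X0 X1 : finType) (N0 N1 : nat).
Variables (x0 : 'I_N0 -> X0) (x1 : 'I_N1 -> X1).
Hypotheses (x0_bij : bijective x0) (x1_bij : bijective x1).
Variables (mu0 : X0 -> R) (mu1 : X1 -> R).
Hypotheses (mu0_prob : full_support_prob mu0) (mu1_prob : full_support_prob mu1).
Let K := coupling_polytope x0 x1 mu0 mu1.

Lemma sum_mxvec_index (g : 'I_(N0 * N1) -> R) :
  \sum_l g l = \sum_i \sum_j g (mxvec_index i j).
Proof.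
rewrite pair_bigA (reindex _ (curry_mxvec_bij _ _)).
by apply: eq_bigr => -[i j] _.
Qed.

Lemma sum_reindex (X : finType) N (y : 'I_N -> X) (mu : X -> R) :
  bijective y -> full_support_prob mu -> \sum_i mu (y i) = 1.
Proof. by move=> yb [_ <-]; rewrite [RHS](reindex y)//; exact: onW_bij. Qed.

Lemma coupling_sum x : K x -> \sum_l x l 0 = 1.
Proof.
move=> [_ Kx _]; rewrite sum_mxvec_index -(sum_reindex x0_bij mu0_prob).
by apply: eq_bigr => i _; exact: Kx.
Qed.

Lemma coupling_01 x l : K x -> 0 <= x l 0 <= 1.
Proof.
move=> Kx; have [x_ge0 _ _] := Kx; rewrite x_ge0/= -(coupling_sum Kx).
by rewrite (bigD1 l)//= lerDl sumr_ge0.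
Qed.

Lemma coupling_norm1 x : K x -> norm1 x = 1.
Proof.
move=> Kx; rewrite -(coupling_sum Kx); apply: eq_bigr => l _.
by rewrite ger0_norm//; have /andP[] := coupling_01 l Kx.
Qed.

(** The product measure is a coupling. *)
Lemma coupling_neq0 : K !=set0.
Proof.
exists (mxvec (\matrix_(i, j) (mu0 (x0 i) * mu1 (x1 j))))^T; split => [l|i|j].
- case/mxvec_indexP: l => i j.
  have [mu0_gt0 _] := mu0_prob; have [mu1_gt0 _] := mu1_prob.
  by rewrite mxE mxvecE mxE mulr_ge0// ltW.
- under eq_bigr do rewrite mxE mxvecE mxE.
  by rewrite -mulr_sumr (sum_reindex x1_bij mu1_prob) mulr1.
- under eq_bigr do rewrite mxE mxvecE mxE.
  by rewrite -mulr_suml (sum_reindex x0_bij mu0_prob) mul1r.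
Qed.

Lemma coupling_convex x y t : K x -> K y -> 0 < t < 1 -> K (x + t *: (y - x)).
Proof.
move=> [x_ge0 x_row x_col] [y_ge0 y_row y_col] /andP[t0 t1]; split => [l|i|j].
- rewrite !mxE; have := mulr_ge0 (ltW t0) (y_ge0 l).
  have t1' : 0 <= 1 - t by lra.
  have := mulr_ge0 t1' (x_ge0 l); lra.
- under eq_bigr do rewrite !mxE.
  by rewrite big_split/= -mulr_sumr sumrB x_row y_row subrr mulr0 addr0.
- under eq_bigr do rewrite !mxE.
  by rewrite big_split/= -mulr_sumr sumrB x_col y_col subrr mulr0 addr0.
Qed.

Lemma coupling_closed : closed K.
Proof.
have -> : K = (\bigcap_l [set x | 0 <= x l 0]) `&`
    (\bigcap_i [set x | \sum_(j < N1) x (mxvec_index i j) 0 = mu0 (x0 i)]) `&`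
    (\bigcap_j [set x | \sum_(i < N0) x (mxvec_index i j) 0 = mu1 (x1 j)]).
  rewrite predeqE => x; split => [[h1 h2 h3]|[[h1 h2] h3]].
    split; [split => l _; [exact: h1|exact: h2]|move=> j _; exact: h3].
  by split => ?; [exact: h1|exact: h2|exact: h3].
have cc l : continuous (fun x : 'cV[R]_(N0 * N1) => x l 0).
  by exact: coord_continuous.
apply: closedI; first apply: closedI.
- apply: closed_bigI => l _; apply: (@preimage_closed _ _ _ [set r : R | 0 <= r]).
    by move=> x _; exact: cc.
  exact: closed_ge.
- apply: closed_bigI => i _.
  apply: (@preimage_closed _ _ (fun x : 'cV[R]_(N0 * N1) =>
    \sum_(j < N1) x (mxvec_index i j) 0) [set mu0 (x0 i)]).
    by move=> x _; apply: continuous_sumR => j; exact: cc.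
  exact: closed_eq.
- apply: closed_bigI => j _.
  apply: (@preimage_closed _ _ (fun x : 'cV[R]_(N0 * N1) =>
    \sum_(i < N0) x (mxvec_index i j) 0) [set mu1 (x1 j)]).
    by move=> x _; apply: continuous_sumR => i; exact: cc.
  exact: closed_eq.
Qed.

End CouplingPolytope.

(** * Inexact accelerated gradient method *)

Section AcceleratedGradient.
Variables (R : realType) (n : nat) (L C : R).
Variables (f : 'cV[R]_n -> R) (G : 'cV[R]_n -> 'cV[R]_n).
Hypotheses (L_gt0 : 0 < L) (C_ge0 : 0 <= C).
Hypothesis f_upper : forall x y,
  f y <= f x + dot (G x) (y - x) + L / 2 * dot (y - x) (y - x).
(** Weak convexity of modulus [C]: the convex case is C = 0, the nonconvex one C = L', so that one
    estimate serves both. *)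
Hypothesis f_lower : forall x y,
  f x + dot (G x) (y - x) - C / 2 * dot (y - x) (y - x) <= f y.

(* [c] is the inverse of the step size of [s]. *)
Lemma agm_step (a c : R) (x s s' u u' z g : 'cV[R]_n) : 0 <= a <= 1 ->
  2 * L * a <= c -> z = a *: s + (1 - a) *: u ->
  dot ((2 * L) *: (z - u') - g) (a *: s' + (1 - a) *: u - u') <= 0 ->
  dot (c *: (s - s') - g) (x - s') <= 0 ->
  f u' - f x <= (1 - a) * (f u - f x) - L / 2 * dot (u' - z) (u' - z)
    + a * c / 2 * (dot (s - x) (s - x) - dot (s' - x) (s' - x))
    - dot (g - G z) (u' - (a *: x + (1 - a) *: u))
    + C / 2 * (a * dot (x - z) (x - z) + (1 - a) * dot (u - z) (u - z)).
Proof.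
move=> /andP[a0 a1] Lac zE hu hs.
have h3 := f_upper z u'.
have h4 := f_lower z u; have h5 := f_lower z x.
(* In these variables the projection inequalities read g.(p + a d) <= -2 L p.(p + a d) and g.e <= c
   d.e. *)
pose p := u' - z; pose d := s - s'; pose e := s' - x.
have uE : (1 - a) *: (u - z) + a *: (x - z) = - a *: (d + e).
  rewrite /d /e zE; apply/matrixP => i j; rewrite !mxE; ring.
have GE : (1 - a) * dot (G z) (u - z) + a * dot (G z) (x - z) =
    - a * (dot (G z) d + dot (G z) e).
  by rewrite -dotDr -[RHS]dotZr -uE [RHS]dotDr !dotZr.
have eE : u' - (a *: x + (1 - a) *: u) = p + a *: (d + e).
  rewrite /p /d /e zE; apply/matrixP => i j; rewrite !mxE; ring.
have wE : a *: s' + (1 - a) *: u - u' = - (p + a *: d).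
  rewrite /p /d zE; apply/matrixP => i j; rewrite !mxE; ring.
have sE : s - x = d + e by rewrite /d /e addrA subrK.
rewrite eE sE -/p -/e.
move: hu; rewrite wE -(opprB u' z) -/p => hu.
move: hs; rewrite -(opprB s' x) -/d -/e => hs.
rewrite -/p in h3; clearbody p d e.
(* This bounds the cross term -2 L a p.d by L |p|^2 + L a^2 |d|^2. As 2 L a <= c, the last term and
   a c d.e together are at most a c / 2 * (|d + e|^2 - |e|^2). *)
have := dot_ge0 (p + a *: d).
set qx := dot (x - z) _ in h5 *; set qu := dot (u - z) _ in h4 *.
move: hu hs h3; rewrite !dotE (dotC d p) (dotC e d) => hu hs h3 h6.
have a1' : 0 <= 1 - a by rewrite subr_ge0.
have h4' := ler_wpM2l a1' h4; have h5' := ler_wpM2l a0 h5.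
have h7 := ler_wpM2l (ltW L_gt0) h6.
have h8 : 0 <= a * (c - 2 * L * a) * dot d d.
  by rewrite !mulr_ge0 ?dot_ge0// subr_ge0.
have hs' := ler_wpM2l a0 hs.
lra.
Qed.

Lemma min_upto_le (J : nat) (b : nat -> R) j : (1 <= j <= J)%N ->
  min_upto J b <= b j.
Proof.
move=> jJ; rewrite /min_upto.
by apply: (@bigmin_inf_seq _ _ _ _ _ j); rewrite ?mem_index_iota ?ltnS.
Qed.

Variables (rad eta : R) (tG : 'cV[R]_n -> 'cV[R]_n) (J : nat).
Variables (s u z : nat -> 'cV[R]_n) (x : 'cV[R]_n).
Hypothesis rad_ge0 : 0 <= rad.
Hypothesis tG_approx : forall y, norm2 y <= rad -> norm2 (tG y - G y) <= eta.
Hypothesis agm : inexact_agm L rad tG J s u z.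
Hypothesis x_ball : norm2 x <= rad.
Hypothesis x_min : is_minimizer f x.

(* The algorithm leaves [u 0] unconstrained and never uses it; [s 0] makes the
   recursion for [z] valid from the first step on. *)
Let v j := if j == 0%N then s 0%N else u j.

Let s_ball j : (j <= J)%N -> norm2 (s j) <= rad.
Proof.
have [s0 _ h] := agm; case: j => [_|j jJ]; first by rewrite inE in s0.
have /= := h j.+1; rewrite jJ => /(_ isT)[_ -> _].
exact: norm2_proj_ball2.
Qed.

Let v_ball j : (j <= J)%N -> norm2 (v j) <= rad.
Proof.
have [s0 _ h] := agm; case: j => [_|j jJ]; first by rewrite inE in s0.
have /= := h j.+1; rewrite jJ /v => /(_ isT)[-> _ _] /=.
exact: norm2_proj_ball2.
Qed.

Let zE j : (j < J)%N ->
  z j.+1 = (2 / (j%:R + 2)) *: s j + (1 - 2 / (j%:R + 2)) *: v j.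
Proof.
have [_ z1 h] := agm; case: j => [_|j jJ].
  by rewrite z1 /v /= -scalerDl addrC subrK scale1r.
by have /= := h j.+1; rewrite (ltnW jJ) /v => /(_ isT)[_ _ ->].
Qed.

(** Induction by [agm_step] with a = 2 / (j + 2) and c = 4 L / (j + 1), times (j + 1) (j + 2) / 2:
    the distance terms then have the constant coefficient 2 L, and the previous gap in f has j (j +
    1) / 2, so both telescope. *)
Lemma agm_energy (m : R) :
  (forall j, (1 <= j <= J)%N -> m <= dot (u j - z j) (u j - z j)) ->
  forall j, (j <= J)%N ->
  j%:R * (j%:R + 1) / 2 * (f (v j) - f x)
    + L / 2 * m * (j%:R * (j%:R + 1) * (j%:R + 2) / 6)
    + 2 * L * dot (s j - x) (s j - x)
  <= 2 * L * dot (s 0%N - x) (s 0%N - x)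
    + 2 * rad * eta * (j%:R * (j%:R + 1) * (j%:R + 2) / 6)
    + C / 2 * (j%:R * (j%:R + 1)) * (norm2 x ^+ 2 + rad ^+ 2).
Proof.
move=> hm; elim=> [_|j IH jJ]; first by rewrite !mul0r !mulr0 !mul0r; lra.
have {}IH := IH (ltnW jJ).
have j0 : 0 <= j%:R :> R by rewrite ler0n.
set t : R := j%:R in IH j0 *.
have tS : j.+1%:R = t + 1 by rewrite -addn1 natrD.
(* Step j + 1 combines tau_j, which formed z_(j+1), with gamma_(j+1), whose inverse is [c] below. *)
set a : R := 2 / (t + 2).
have t2 : 0 < t + 2 by lra.
have a0 : 0 <= a by rewrite divr_ge0// ltW.
have a1 : a <= 1 by rewrite ler_pdivrMr//; lra.
have a01 : 0 <= a <= 1 by rewrite a0.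
pose c := 4 * L / (t + 1).
have t1 : 0 < t + 1 by lra.
have Lac : 2 * L * a <= c.
  rewrite /c ler_pdivlMr// /a -subr_ge0.
  have -> : 4 * L - 2 * L * (2 / (t + 2)) * (t + 1) = 4 * L / (t + 2).
    by field; rewrite gt_eqF.
  by rewrite divr_ge0 ?mulr_ge0// ltW.
have zjE := zE jJ; rewrite -/t -/a in zjE.
have z_ball : norm2 (z j.+1) <= rad.
  rewrite zjE; apply: norm2_conv => //; first exact: s_ball (ltnW jJ).
  exact: v_ball (ltnW jJ).
have [_ _ /(_ j.+1)] := agm; rewrite jJ => /(_ isT) /= [uE sE _].
set g := tG (z j.+1) in uE sE.
have w_ball : norm2 (a *: s j.+1 + (1 - a) *: v j) <= rad.
  by apply: norm2_conv => //; [exact: s_ball jJ|exact: v_ball (ltnW jJ)].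
have hu : dot ((2 * L) *: (z j.+1 - u j.+1) - g)
    (a *: s j.+1 + (1 - a) *: v j - u j.+1) <= 0.
  have := proj_ball2_obtuse (z j.+1 - (1 / (2 * L)) *: g) w_ball.
  rewrite -uE -(@ler_pM2l _ (2 * L)) ?mulr_gt0// mulr0 -dotZl.
  rewrite addrAC scalerBr scalerA (_ : 2 * L * _ = 1) ?scale1r//.
  by field; rewrite gt_eqF.
have hs : dot (c *: (s j - s j.+1) - g) (x - s j.+1) <= 0.
  have := proj_ball2_obtuse (s j - (j.+1%:R / (4 * L)) *: g) x_ball.
  have c0 : 0 < c by rewrite divr_gt0 ?mulr_gt0.
  rewrite -sE -(@ler_pM2l _ c)// mulr0 -dotZl.
  rewrite addrAC scalerBr scalerA (_ : c * _ = 1) ?scale1r//.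
  by rewrite /c tS; field; rewrite !gt_eqF.
have := agm_step a01 Lac zjE hu hs.
rewrite (_ : v j.+1 = u j.+1)// tS.
have := hm j.+1; rewrite jJ => /(_ isT).
(* The gradient error is paired with a difference of two points of the ball, of norm at most 2
   rad. *)
have : - dot (g - G (z j.+1)) (u j.+1 - (a *: x + (1 - a) *: v j))
    <= 2 * rad * eta.
  rewrite -dotNl; apply: (le_trans (cauchy_schwarz _ _)).
  rewrite norm2N mulrC; apply: ler_pM; rewrite ?norm2_ge0 ?tG_approx//.
  apply: (le_trans (norm2D _ _)); rewrite norm2N mulr_natl mulr2n.
  apply: lerD; first exact: v_ball jJ.
  by apply: norm2_conv => //; exact: v_ball (ltnW jJ).
(* As z is the a-average of s and v, the left-hand side equals a times the a-average of |x - s|^2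
   and |x - v|^2. The factor a keeps the weighted sum of these terms quadratic in j. *)
have : a * dot (x - z j.+1) (x - z j.+1) +
    (1 - a) * dot (v j - z j.+1) (v j - z j.+1) <= a * (2 * (norm2 x ^+ 2 + rad ^+ 2)).
  have bd y : norm2 y <= rad ->
      dot (x - y) (x - y) <= 2 * (norm2 x ^+ 2 + rad ^+ 2).
    move=> yr; have := dot_ge0 (x + y); rewrite !dotE (dotC y x).
    have : dot y y <= rad ^+ 2 by rewrite -norm2_le.
    rewrite sqr_norm2; lra.
  have := bd _ (s_ball (ltnW jJ)); have := bd _ (v_ball (ltnW jJ)).
  have -> : a * dot (x - z j.+1) (x - z j.+1) +
      (1 - a) * dot (v j - z j.+1) (v j - z j.+1) =
      a * (a * dot (x - s j) (x - s j) + (1 - a) * dot (x - v j) (x - v j)).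
    rewrite zjE !dotE (dotC (s j) x) (dotC (v j) x) (dotC (v j) (s j)); ring.
  move=> hv hs'; apply: ler_wpM2l => //.
  have := ler_wpM2l a0 hs'; have : 0 <= 1 - a by lra.
  move=> /ler_wpM2l /(_ _ _ hv); lra.
set E1 := - dot _ _; set E2 := a * _ + _ * _.
set P := dot (u _ - _) _; set X := norm2 x ^+ 2 + _ in IH *.
set D0 := dot (s j - x) _ in IH *; set D1 := dot (s j.+1 - x) _.
set F1 := f (u _) - _; set F0 := f (v j) - _ in IH *.
move=> hE2 hE1 hP hF.
have k0 : 0 <= (t + 1) * (t + 2) / 2 by rewrite divr_ge0 ?mulr_ge0// ltW.
have := ler_wpM2l k0 hF; have := ler_wpM2l k0 hE1.
have : 0 <= (t + 1) * (t + 2) / 2 * (C / 2)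
  by exact: mulr_ge0 k0 (divr_ge0 C_ge0 (ler0n _ 2)).
move=> /ler_wpM2l /(_ _ _ hE2).
have : 0 <= (t + 1) * (t + 2) / 2 * (L / 2)
  by exact: mulr_ge0 k0 (divr_ge0 (ltW L_gt0) (ler0n _ 2)).
move=> /ler_wpM2l /(_ _ _ hP).
have aE : (t + 1) * (t + 2) / 2 * a = t + 1.
  by rewrite /a; field; rewrite gt_eqF.
have acE : (t + 1) * (t + 2) / 2 * (a * c / 2) = 2 * L.
  by rewrite /a /c; field; rewrite !gt_eqF.
have -> : (t + 1) * (t + 2) / 2 * (C / 2) * (a * (2 * X)) = C * (t + 1) * X.
  by rewrite -[in RHS]aE; field.
have e1 : (t + 1) * (t + 2) / 2 * (a * c / 2 * (D0 - D1)) = 2 * L * (D0 - D1).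
  by rewrite -acE !mulrA.
have e2 : (t + 1) * (t + 2) / 2 * ((1 - a) * F0) = t * (t + 1) / 2 * F0.
  rewrite mulrA; congr (_ * _); rewrite mulrBr mulr1 aE.
  by field.
lra.
Qed.

Lemma agm_rate : (1 <= J)%N ->
  min_upto J (fun j => norm2 ((2 * L) *: (u j - z j)) ^+ 2) <=
    96 * L ^+ 2 / (J%:R * (J%:R + 1) * (J%:R + 2)) * norm2 (s 0%N - x) ^+ 2
    + 24 * L * C / J%:R * (norm2 x ^+ 2 + 5 / 4 * rad ^+ 2)
    + 16 * L * rad * eta.
Proof.
move=> J1; set mu := min_upto _ _.
pose m := mu / (4 * L ^+ 2).
have L2 : 0 < 4 * L ^+ 2 by rewrite mulr_gt0 ?exprn_gt0.
have hm j : (1 <= j <= J)%N -> m <= dot (u j - z j) (u j - z j).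
  move=> jJ; rewrite /m ler_pdivrMr//.
  apply: (le_trans (min_upto_le _ jJ)).
  by rewrite sqr_norm2 !dotE; lra.
have := agm_energy hm (leqnn J).
have t0 : 0 < J%:R :> R by rewrite ltr0n.
set t : R := J%:R in t0 *.
have vJ : 0 <= f (v J) - f x by rewrite subr_ge0; exact: x_min.
have h1 : 0 <= t * (t + 1) / 2 * (f (v J) - f x).
  by rewrite mulr_ge0// divr_ge0// mulr_ge0// ?ltW//; lra.
have h2 : 0 <= 2 * L * dot (s J - x) (s J - x).
  by rewrite mulr_ge0 ?dot_ge0// mulr_ge0// ltW.
have -> : mu = m * (4 * L ^+ 2) by rewrite /m divfK// gt_eqF.
rewrite (sqr_norm2 (s 0%N - x)).
set X := norm2 x ^+ 2; set D := dot (s 0%N - x) _; set DJ := dot (s J - x) _ in h2 *.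
have X0 : 0 <= X by rewrite sqr_ge0.
have T0 : 0 < t * (t + 1) * (t + 2) by rewrite !mulr_gt0//; lra.
move=> h.
have {}h : L / 2 * m * (t * (t + 1) * (t + 2) / 6) <=
    2 * L * D + 2 * rad * eta * (t * (t + 1) * (t + 2) / 6)
    + C / 2 * (t * (t + 1)) * (X + rad ^+ 2) by lra.
(* This factor turns the coefficient of m into 4 L^2, so that the left-hand side becomes [mu]. *)
have h3 : 0 <= 48 * L / (t * (t + 1) * (t + 2)).
  by apply: divr_ge0; [apply: mulr_ge0 => //; exact: ltW|exact: ltW].
have := ler_wpM2l h3 h.
have -> : 48 * L / (t * (t + 1) * (t + 2)) *
    (L / 2 * m * (t * (t + 1) * (t + 2) / 6)) = m * (4 * L ^+ 2).
  by field; rewrite !gt_eqF//; lra.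
move=> /le_trans; apply.
have -> : 48 * L / (t * (t + 1) * (t + 2)) *
    (2 * L * D + 2 * rad * eta * (t * (t + 1) * (t + 2) / 6)
    + C / 2 * (t * (t + 1)) * (X + rad ^+ 2)) =
    96 * L ^+ 2 / (t * (t + 1) * (t + 2)) * D +
    24 * L * C * ((t + 2)^-1 * (X + rad ^+ 2)) + 16 * L * rad * eta.
  by field; rewrite !gt_eqF//; lra.
rewrite lerD2r lerD2l -[leRHS]mulrA; apply: ler_wpM2l.
  by apply: mulr_ge0 => //; apply: mulr_ge0 => //; exact: ltW.
(* The curvature term comes out as (|x|^2 + rad^2) / (J + 2) and is relaxed to the stated form with
   1 / J and 5/4. *)
have h4 : (t + 2)^-1 <= t^-1 by rewrite lef_pV2 ?posrE; lra.
apply: ler_pM => //; first by rewrite invr_ge0; lra.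
  by rewrite addr_ge0 ?sqr_ge0.
by have := sqr_ge0 rad; lra.
Qed.

End AcceleratedGradient.

(** * Lipschitz constants and convergence rates for the coupling objective *)

Theorem theorem5 (R : realType) (X0 X1 : finType) (N0 N1 : nat)
    (x0 : 'I_N0 -> X0) (x1 : 'I_N1 -> X1)
    (x0_bij : bijective x0) (x1_bij : bijective x1)
    (mu0 : X0 -> R) (mu1 : X1 -> R)
    (mu0_prob : full_support_prob mu0) (mu1_prob : full_support_prob mu1)
    (p : R) (p_gt0 : 0 < p)
    (kappa0 : X0 -> X0 -> R) (kappa1 : X1 -> X1 -> R)
    (r0 r1 : nat) (B0 : 'M[R]_(r0, N0 * N1)) (B1 : 'M[R]_(r1, N0 * N1))
    (M : 'M[R]_(N0 * N1)) (M_def : M = B1^T *m B1 - B0^T *m B0)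
    (M_distortion : forall (x : 'cV[R]_(N0 * N1)) (pi : X0 * X1 -> R),
      is_coupling mu0 mu1 pi -> represents x0 x1 x pi ->
      2^-1 * dot x (M *m x) = distortion p kappa0 kappa1 pi)
    (eps : R) (eps_gt0 : 0 < eps) :
  let ell := objective (coupling_polytope x0 x1 mu0 mu1) B0 B1 eps in
  let R0 := norm12 B0 in
  let ratio := lambda_max (B0^T *m B0) / (lambda_min (B1^T *m B1) + eps) in
  let L := Num.max 1 (ratio - 1) in
  let ell' := fun u : 'cV[R]_r0 => ell u - 2^-1 * norm2 u ^+ 2 in
  [/\ forall u, differentiable ell u,
      lipschitz2 (grad ell) L,
      lipschitz2 (grad ell') ratio &
      forall (eta' : R) (tgrad : 'cV[R]_r0 -> 'cV[R]_r0), 0 < eta' ->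
        (forall u, u \in ball2 R0 -> norm2 (tgrad u - grad ell u) <= eta') ->
      forall (J : nat) (s u z : nat -> 'cV[R]_r0), (1 <= J)%N ->
        inexact_agm L R0 tgrad J s u z ->
      forall ustar : 'cV[R]_r0, is_minimizer ell ustar ->
        (convex ell ->
          min_upto J (fun j => norm2 ((2 * L) *: (u j - z j)) ^+ 2) <=
            96 * L ^+ 2 / (J%:R * (J%:R + 1) * (J%:R + 2))
              * norm2 (s 0%N - ustar) ^+ 2
            + 16 * L * R0 * eta') /\
        (~ convex ell -> forall L' : R, lipschitz2 (grad ell') L' ->
          min_upto J (fun j => norm2 ((2 * L) *: (u j - z j)) ^+ 2) <=
            96 * L ^+ 2 / (J%:R * (J%:R + 1) * (J%:R + 2))
              * norm2 (s 0%N - ustar) ^+ 2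
            + 24 * L * L' / J%:R * (norm2 ustar ^+ 2 + 5 / 4 * R0 ^+ 2)
            + 16 * L * R0 * eta')].
Proof.
move=> ell R0 ratio L ell'.
pose K := coupling_polytope x0 x1 mu0 mu1.
have K_neq0 : K !=set0 by exact: coupling_neq0.
(* A coupling has total mass 1, so its index set is not empty; the eigenvalue bounds rest on
   this. *)
have k_gt0 : (0 < N0 * N1)%N.
  have [x /(coupling_sum x0_bij mu0_prob)] := K_neq0.
  case: (N0 * N1)%N x => // x; rewrite big_ord0 => /eqP.
  by rewrite eq_sym oner_eq0.
have lmin_ge0 := lambda_min_gram_ge0 B1 k_gt0.
have lmax_ge0 := lambda_max_gram_ge0 B0 k_gt0.
have ratio_ge0 : 0 <= ratio by rewrite divr_ge0// addr_ge0// ltW.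
have K_01 x l : K x -> 0 <= x l 0 <= 1 by exact: coupling_01.
have K_convex x y t : K x -> K y -> 0 < t < 1 -> K (x + t *: (y - x)).
  exact: coupling_convex.
have [F [F_K F_concave F_coco]] := objective_structure eps_gt0 K_neq0
  (@coupling_closed _ _ _ _ _ x0 x1 mu0 mu1) K_01 K_convex
  (gram_le_lambda_max B0 k_gt0) (lambda_min_le_gram B1 k_gt0) lmin_ge0 lmax_ge0.
rewrite -/ell in F_concave F_coco; rewrite -/ratio in F_coco.
have ellD u := ell_diff ratio_ge0 F_concave F_coco u.
have ell_grad u : grad ell u = u - F u by have [] := ellD u.
have ell'_grad u : grad ell' u = - F u.
  exact: f_grad ratio_ge0 F_concave F_coco u.
have L1 : 1 <= L by rewrite le_max lexx.
have L_gt0 : 0 < L by exact: lt_le_trans L1.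
have F_ball u : norm2 (F u) <= R0.
  have [x Kx ->] := F_K u; apply: norm2_le_norm12 => //.
  by rewrite (coupling_norm1 x0_bij mu0_prob Kx).
split => [u|u w|u w|eta' tgrad eta_gt0 tgradP J s u z J1 agm ustar ustar_min].
- by have [] := ellD u.
- by rewrite !ell_grad; exact: id_sub_F_lipschitz ratio_ge0 F_concave F_coco _ _.
- have -> : grad ell' u - grad ell' w = - (F u - F w).
    by rewrite !ell'_grad opprB addrC opprK.
  rewrite norm2N.
  exact: F_lipschitz ratio_ge0 F_coco _ _.
(* A minimizer is a fixed point of [F], whose values lie in the ball. *)
have ustar_ball : norm2 ustar <= R0.
  by rewrite -(ell_minimizer F_concave ustar_min).
have tgrad_approx y : norm2 y <= R0 -> norm2 (tgrad y - grad ell y) <= eta'.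
  by move=> yR; apply: tgradP; rewrite inE.
(* The curvature of [ell] is at most 1, and 1 <= L. *)
have upper x y : ell y <= ell x + dot (grad ell x) (y - x)
    + L / 2 * dot (y - x) (y - x).
  rewrite ell_grad; apply: (le_trans (ell_upper F_concave x y)).
  have := dot_ge0 (y - x); nra.
have R0_ge0 : 0 <= R0 := norm12_ge0 B0 k_gt0.
split => [ell_cvx|ell_ncvx L' ell'_lip].
  have lower x y : ell x + dot (grad ell x) (y - x)
      - 0 / 2 * dot (y - x) (y - x) <= ell y.
    rewrite ell_grad mul0r mul0r subr0.
    exact: ell_convex_lower ratio_ge0 F_concave F_coco ell_cvx x y.
  have := agm_rate L_gt0 (lexx 0) upper lower R0_ge0 tgrad_approx agm
    ustar_ball ustar_min J1.
  by rewrite mulr0 !mul0r addr0.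
have L'_ge0 := nonconvex_lipschitz_ge0 ell_ncvx ell'_lip.
have lower x y : ell x + dot (grad ell x) (y - x)
    - L' / 2 * dot (y - x) (y - x) <= ell y.
  rewrite ell_grad.
  have := f_lower_lipschitz ratio_ge0 F_concave F_coco ell'_lip x y.
  have := ellE ell F x y; have := dot_ge0 (y - x); lra.
by have := agm_rate L_gt0 L'_ge0 upper lower R0_ge0 tgrad_approx agm
  ustar_ball ustar_min J1.
Qed.
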